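(* Let $f_x(s)$ be a PSIAC kernel of degree $k$ and reproduction degree $r$ with index sequence $\mathcal J=(j_0,\dots,j_r)$ and knot sequence $h t_{0:n}+x-h\lambda$, i.e. for every $x$, $f_x$ is the SIAC spline kernel of reproduction degree $r$ with index sequence $\mathcal J$ over these knots. Let $u(x,\tau)=\sum_{i=0}^m u_i(\tau)\,\phi_i(x;hs_{0:m})$, $x\in[a,b]$, $\tau\ge0$, be the DG output, and let $\mathcal I$ be the set of indices $i$ of basis functions $\phi_i(\cdot\,;hs_{0:m})$ with support overlapping $h[\lambda-t_n,\lambda-t_0]$. Let $\mathbf u_{\mathcal I}:=[u_i(\tau)]_{i\in\mathcal I}$ (row vector) and $(u*f_x)(x)=\int_{\mathbb R}f_x(s)\,u(x-s,\tau)\,\mathrm ds$. Then for every integer $\ell\ge0$, $$\frac{\mathrm d^\ell}{\mathrm dx^\ell}\big(u*f_x\big)(x)=\mathbf u_{\mathcal I}\;Q_\lambda\;\operatorname{diag}(1,h^{-1},\dots,h^{-r})\;\Big(\frac{\mathrm d^\ell}{\mathrm dx^\ell}\big(1,\,x-h\lambda,\,\dots,(x-h\lambda)^r\big)\Big)^{\mathsf T},$$ where $$Q_\lambda:=G_\lambda\,A\,M_{0,\mathbf t,\mathcal J}^{-1}\,\operatorname{diag}\Big(\big[(-1)^i\tbinom{i+k+1}{i}\big]_{i=0,\dots,r}\Big),\qquad G_\lambda:=\Big[\int_{\lambda-t_n}^{\lambda-t_0}\phi_i(s;s_{0:m})\,B(s\,|\,\lambda-t_{n-j:j_r-j})\,\mathrm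 ds\Big]_{i\in\mathcal I,\ j\in\mathcal J},$$ and $A$ is the reversal matrix ($1$ on the antidiagonal and $0$ elsewhere).
   Context: Notation: $t_{i:j}=(t_i,\dots,t_j)$, with indices descending if $i>j$; operations such as $h t_{i:j}+\xi$ and $\lambda - t_{i:j}$ act entrywise. For a non-decreasing sequence $t_{i:j}$ and sufficiently smooth $g$, divided differences are $\Delta(t_i)g=g(t_i)$ and, for $j>i$, $\Delta(t_{i:j})g=(\Delta(t_{i+1:j})g-\Delta(t_{i:j-1})g)/(t_j-t_i)$ if $t_i\ne t_j$, and $=g^{(j-i)}(t_i)/(j-i)!$ if $t_i=t_j$. B-spline: for knots $t_i\le\dots\le t_{i+k+1}$ (not all equal), $B(x\,|\,t_{i:i+k+1}):=(k+1)\,\Delta(t_{i:i+k+1})\big(\max\{\cdot-x,0\}\big)^k$ is the B-spline of degree $k$ with unit integral (values at knots are immaterial). The knots of every B-spline that occurs are assumed not to be all equal. SIAC spline kernel: let $\mathcal J=(j_0,\dots,j_r)$ be strictly increasing integers with $j_0=0$, let $n=j_r+k+1$, and let $t_{0:n}$ be non-decreasing real knots. The SIAC spline kernel of degree $k$ and reproduction degree $r$ with index sequence $\mathcal J$ and knots $t_{0:n}$ is the spline $f=\sum_{j\in\mathcal J} f_{j}\,B(\cdot\,|\,t_{j:j+k+1})$ whose coefficients are such that $\big(f*(-\cdot)^\delta\big)(x)=(-x)^\delta$ for all $x\in\mathbb R$, $\delta=0,\dots,r$, where $(f*g)(x)=\int_{\mathbb R} f(t)g(x-t)\,\mathrm dt$.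 Reproduction matrix: $M_{0,\mathbf t,\mathcal J}:=\big[\Delta(t_{j:j+k+1})\,x^{k+1+\delta}\big]_{\delta=0,\dots,r,\ j\in\mathcal J}$ (divided difference of the monomial $x\mapsto x^{k+1+\delta}$), an invertible $(r+1)\times(r+1)$ matrix, with $\mathbf t=t_{0:n}$. DG setting: $h>0$, $\lambda\in\mathbb R$, $a=hs_0<\dots<hs_m=b$ are break points. The basis functions $\phi_i(\cdot\,;hs_{0:m})$, $0\le i\le m$, are linearly independent integrable real functions on $[a,b]$, regarded as zero outside $[a,b]$, and satisfy $\phi_i(hx;hs_{0:m})=\phi_i(x;s_{0:m})$. The $u_i(\tau)$ are real-valued.
   Formalization: The columns of G_λ run over the reflected index sequence (j_r−j_r, j_r−j_{r−1}, …, j_r−j_0) instead of J; the printed formula fails for asymmetric J (e.g. k=0, J=(0,1,3), t_i=i). For symmetric J, such as (0,…,r), the two formulas coincide. *)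

(* Defs.v *)
From mathcomp Require Import all_boot all_order all_algebra.
From mathcomp Require Import all_classical all_reals all_analysis.
Set Implicit Arguments.
Unset Strict Implicit.
Unset Printing Implicit Defensive.
Import Order.TTheory GRing.Theory Num.Theory.
Import numFieldNormedType.Exports.
Local Open Scope classical_set_scope.
Local Open Scope ring_scope.

(* A knot sequence t_0, t_1, ... is a function nat -> R of which only finitely
   many values matter.  [ascending t i] is t_i, t_{i+1}, ..., and
   [descending t i] is t_i, t_{i-1}, ..., t_0. *)
Definition ascending (R : realType) (t : nat -> R) (i : nat) : nat -> R :=
  fun p => t (i + p)%N.

Definition descending (R : realType) (t : nat -> R) (i : nat) : nat -> R :=
  fun p => t (i - p)%N.

(* Divided difference of g over the d + 1 knots t_0 <= ... <= t_d. *)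
Fixpoint divdiff (R : realType) (d : nat) (t : nat -> R) (g : R -> R) : R :=
  if d is d'.+1 then
    if t 0%N == t d then derive1n d g (t 0%N) / (d`!)%:R
    else (divdiff d' (ascending t 1) g - divdiff d' t g) / (t d - t 0%N)
  else g (t 0%N).

(* max{y - x, 0}^k.  The test is needed for k = 0, where the power is the
   indicator of x <= y, whereas (Num.max (y - x) 0) ^+ 0 would be constantly 1. *)
Definition truncpow (R : realType) (k : nat) (x y : R) : R :=
  if x <= y then (y - x) ^+ k else 0.

(* The B-spline of degree k with knots t_0 <= ... <= t_{k+1}, evaluated at x.
   At a knot, a derivative in [divdiff] may fail to exist, and the value is
   then irrelevant. *)
Definition bspline (R : realType) (k : nat) (t : nat -> R) (x : R) : R :=
  k.+1%:R * divdiff k.+1 t (truncpow k x).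

Definition convolution (R : realType) (f g : R -> R) (x : R) : R :=
  Rintegral (@lebesgue_measure R) setT (fun s => f s * g (x - s)).

(* The index sequence is (J 0, ..., J r), and the knots are t_0, ..., t_n with
   n = J r + k + 1.  The values of f at the knots are left free. *)
Definition siac_kernel (R : realType) (k r : nat) (J : 'I_r.+1 -> nat)
    (t : nat -> R) (f : R -> R) : Prop :=
  (exists c : 'I_r.+1 -> R,
     forall s : R, (forall p, (p <= J ord_max + k + 1)%N -> s <> t p) ->
       f s = \sum_(q < r.+1) c q * bspline k (ascending t (J q)) s)
  /\ (forall d : nat, (d <= r)%N ->
        forall x : R, convolution f (fun y => (- y) ^+ d) x = (- x) ^+ d).

Definition reproduction_mx (R : realType) (k r : nat) (J : 'I_r.+1 -> nat)
    (t : nat -> R) : 'M[R]_r.+1 :=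
  \matrix_(d < r.+1, q < r.+1)
    divdiff k.+1 (ascending t (J q)) (fun x : R => x ^+ (k + 1 + d)).

Definition reversal_mx (R : realType) (r : nat) : 'M[R]_r.+1 :=
  \matrix_(p < r.+1, q < r.+1) (q == rev_ord p)%:R.

Definition fun_support (R : realType) (f : R -> R) : set R :=
  closure [set y | f y != 0].

Definition overlapping (R : realType) (m : nat) (b : 'I_m.+1 -> R -> R)
    (K : set R) : {set 'I_m.+1} :=
  [set i | `[< fun_support (b i) `&` K !=set0 >]]%SET.

Definition linearly_independent_on (R : realType) (m : nat) (D : set R)
    (b : 'I_m.+1 -> R -> R) : Prop :=
  forall c : 'I_m.+1 -> R,
    (forall y, D y -> \sum_(i < m.+1) c i * b i y = 0) -> forall i, c i = 0.

(* The index sequence of the reflected knots lambda - t_n <= ... <= lambda - t_0,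
   that is (j_r - j_r, j_r - j_{r-1}, ..., j_r - j_0). *)
Definition mirror (r : nat) (J : 'I_r.+1 -> nat) : 'I_r.+1 -> nat :=
  fun q => (J ord_max - J (rev_ord q))%N.

Lemma mirror_symmetric (r : nat) (J : 'I_r.+1 -> nat) :
  (forall q, (J q + J (rev_ord q))%N = J ord_max) -> mirror J = J.
Proof.
move=> symJ; apply/funext => q.
by rewrite /mirror -(symJ q) addnK.
Qed.

(* Columns are indexed by an index sequence J for the reflected knots
   lambda - t_n <= ... <= lambda - t_0, so that the column of j carries the
   B-spline with knots lambda - t_{n-j}, ..., lambda - t_{n-j-k-1}. *)
Definition G_mx (R : realType) (k r m n : nat) (J : 'I_r.+1 -> nat)
    (t : nat -> R) (lambda : R) (b : 'I_m.+1 -> R -> R) (I : {set 'I_m.+1}) :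
    'M[R]_(#|I|, r.+1) :=
  \matrix_(p < #|I|, q < r.+1)
    Rintegral (@lebesgue_measure R) `[lambda - t n, lambda - t 0%N]
      (fun s => b (enum_val p) s *
                bspline k (fun l => lambda - descending t (n - J q) l) s).

(* With [G_mx] over J itself instead of [mirror J], column q of [G_mx] would
   belong to the knots starting at t_{j_r - j_q}, whereas row q of
   [reversal_mx *m invmx M] belongs to those starting at t_{j_{r-q}}.  These
   agree for all q exactly when J is symmetric, that is
   j_q + j_{r-q} = j_r, and then [mirror J] = J by [mirror_symmetric]. *)
Definition Q_mx (R : realType) (k r m n : nat) (J : 'I_r.+1 -> nat)
    (t : nat -> R) (lambda : R) (b : 'I_m.+1 -> R -> R) (I : {set 'I_m.+1}) :
    'M[R]_(#|I|, r.+1) :=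
  G_mx k n (mirror J) t lambda b I *m reversal_mx R r
    *m invmx (reproduction_mx k J t)
    *m diag_mx (\row_(i < r.+1) ((-1) ^+ i * 'C(i + k + 1, i)%:R)).

(* Main.v *)
Require Import Defs.
From mathcomp Require Import all_boot all_order all_algebra.
From mathcomp Require Import all_classical all_reals all_analysis.
From mathcomp Require Import measurable_realfun.
From mathcomp Require Import ring lra zify.

(** Write [xi] for [y - h * lambda]. The kernel [f y] is a combination of
    B-splines whose knots are those of [t], scaled by [h] and shifted by [xi].
    Both ingredients of the convolution depend on [y] in a very simple way.

    The coefficients of the combination are determined by the moments of
    [f y] about [xi], which reproduction prescribes. Peano's formula
    ([bspline_germ_moment]) says that the integral of a B-spline against the
    derivative of order [k.+1] of a polynomial, divided by [(k.+1)`!], is the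
    divided difference of that polynomial over the knots. Hence the moments turn
    into a linear system ([siac_kernel_coefficients]) with the reproduction
    matrix of [t] as its matrix, and with a right-hand side that depends on
    [y] only through the powers of [xi].

    The convolution of a single B-spline with a basis function does not depend
    on [y] at all ([Rintegral_bspline_flip]): an affine substitution turns it
    into an entry of the matrix [G_mx]. Therefore the convolution is a polynomial
    in [xi], whose coefficients form the row vector of the statement, and it can
    be differentiated term by term.

    The reproduction matrix is invertible ([reproduction_mx_unit]) because a
    combination of divided differences that annihilates many powers needs many
    sign changes among its coefficients ([sign_changes_annihilator]). This
    follows from summation by parts and a discrete version of Rolle's theorem.

    The truncated power is only piecewise polynomial, while its divided
    difference over multiple knots involves derivatives. Off the knots, however,
    it is polynomial near every knot, and a divided difference depends on these
    polynomial germs only ([divdiff_germ]). Thus divided differences are handled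
    algebraically on germs, and B-splines are replaced by the version
    [bspline_germ], which is defined everywhere and differs from them at
    finitely many points. *)

Set Implicit Arguments.
Unset Strict Implicit.
Unset Printing Implicit Defensive.
Import Order.TTheory GRing.Theory Num.Theory.
Import numFieldNormedType.Exports.
Local Open Scope classical_set_scope.
Local Open Scope ring_scope.

(** * Taylor coefficients of polynomials *)

Section poly.
Variable R : numFieldType.
Implicit Types (p q : {poly R}) (c e x y : R).

Lemma derivn_comp_affine n p c e :
  (p \Po (c *: 'X + e%:P))^`(n) = c ^+ n *: (p^`(n) \Po (c *: 'X + e%:P)).
Proof.
elim: n => [|n IHn]; first by rewrite !derivn0 expr0 scale1r.
rewrite !derivnS IHn derivZ deriv_comp derivD derivZ derivX derivC addr0.
by rewrite -scalerAr mulr1 exprSr -[RHS]scalerA.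
Qed.

Lemma nderivnE n p : p^`N(n) = n`!%:R^-1 *: p^`(n).
Proof.
rewrite nderivn_def -[p^`N(n) *+ n`!]scaler_nat scalerA mulVf ?scale1r //.
Qed.

Lemma nderivn_comp_affine n p c e :
  (p \Po (c *: 'X + e%:P))^`N(n) = c ^+ n *: (p^`N(n) \Po (c *: 'X + e%:P)).
Proof. by rewrite !nderivnE derivn_comp_affine comp_polyZ !scalerA mulrC. Qed.

Lemma derivnXsubCM n c p :
  (('X - c%:P) * p)^`(n.+1) = ('X - c%:P) * p^`(n.+1) + p^`(n) *+ n.+1.
Proof.
elim: n => [|n IHn].
  by rewrite !derivn1 derivn0 derivM derivXsubC mul1r addrC mulr1n.
rewrite derivnS IHn derivD derivM derivXsubC mul1r derivMn -!derivnS.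
by rewrite [p^`(n.+1) *+ n.+2]mulrS [RHS]addrCA addrA.
Qed.

Lemma horner_nderivnXsubCM n c p :
  (('X - c%:P) * p)^`N(n.+1).[c] = p^`N(n).[c].
Proof.
rewrite !nderivnE derivnXsubCM !hornerZ hornerD hornerM hornerMn !hornerE.
rewrite subrr mul0r add0r -[_ *+ n.+1]mulr_natl mulrA factS natrM invfM.
by congr (_ * _); rewrite mulrAC mulVf ?mul1r.
Qed.
End poly.

(** * Divided differences of polynomial germs *)

(** The divided difference of a function that coincides near each knot [y] with
    the polynomial [P y]. Coinciding knots share their germ, so the data needed
    at a multiple knot is just a coefficient of the Taylor expansion of the
    germ there. *)
Fixpoint germ_divdiff (R : realType) (d : nat) (t : nat -> R)
    (P : R -> {poly R}) : R :=
  if d is d'.+1 then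
    if t 0%N == t d then (P (t 0%N))^`N(d).[t 0%N]
    else (germ_divdiff d' (ascending t 1) P - germ_divdiff d' t P)
         / (t d - t 0%N)
  else (P (t 0%N)).[t 0%N].

Section germ.
Variable R : realType.
Implicit Types (d : nat) (t : nat -> R) (P Q : R -> {poly R}).

Lemma eq_germ_divdiff d t t' P Q :
  (forall i, (i <= d)%N -> t i = t' i) ->
  (forall i, (i <= d)%N -> P (t i) = Q (t i)) ->
  germ_divdiff d t P = germ_divdiff d t' Q.
Proof.
elim: d t t' => [|d IHd] t t' tt' PQ /=; first by rewrite PQ// tt'.
rewrite PQ// !tt'//; case: ifP => // _; congr ((_ - _) / _).
- by apply: IHd => i id; rewrite /ascending ?tt'// -?tt'// PQ.
- by apply: IHd => i id; [rewrite tt'// ltnW|rewrite PQ// ltnW].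
Qed.

Lemma germ_divdiffS d t P :
  germ_divdiff d.+1 t P =
    if t 0%N == t d.+1 then (P (t 0%N))^`N(d.+1).[t 0%N]
    else (germ_divdiff d (ascending t 1) P - germ_divdiff d t P)
         / (t d.+1 - t 0%N).
Proof. by []. Qed.

Lemma germ_divdiff_lin d t a P Q :
  germ_divdiff d t (fun y => a *: P y + Q y)
  = a * germ_divdiff d t P + germ_divdiff d t Q.
Proof.
elim: d t => [|d IHd] t /=; first by rewrite hornerD hornerZ.
case: ifP => _; first by rewrite nderivnD nderivnZ hornerD hornerZ.
by rewrite !IHd; ring.
Qed.

Lemma germ_divdiff0 d t : germ_divdiff d t (fun=> 0) = 0.
Proof.
elim: d t => [|d IHd] t /=; first by rewrite horner0.
by rewrite !IHd nderivn_poly0 ?size_poly0// horner0 subrr mul0r if_same.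
Qed.

Lemma germ_divdiffZ d t a P :
  germ_divdiff d t (fun y => a *: P y) = a * germ_divdiff d t P.
Proof.
rewrite -[RHS]addr0 -(germ_divdiff0 d t) -germ_divdiff_lin.
by apply: eq_germ_divdiff => // i _; rewrite addr0.
Qed.

(** Combined with [germ_divdiff_affine] for a negative slope, this gives the
    effect of reflecting a knot sequence while keeping it nondecreasing. *)
Lemma germ_divdiff_rev d t P :
  germ_divdiff d (fun l => t (d - l)%N) P = germ_divdiff d t P.
Proof.
elim: d t => [|d IHd] t //=.
rewrite subnn subn0 eq_sym; case: eqVneq => [-> //|t_neq].
rewrite -(IHd t) -(IHd (ascending t 1)).
rewrite (_ : ascending _ 1 = fun l => t (d - l)%N); last first.
  by apply/funext => l; rewrite /ascending add1n subSS.
rewrite (@eq_germ_divdiff d (fun l => t (d.+1 - l)%N)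
    (fun l => ascending t 1 (d - l)%N) P P) //; last first.
  by move=> i id; rewrite /ascending add1n subSn.
by rewrite -[t 0 - t d.+1]opprB invrN mulrN -mulNr opprB.
Qed.

Lemma germ_divdiff_affine d t (c e : R) P : c != 0 ->
  germ_divdiff d (fun l => c * t l + e) P
  = c ^- d * germ_divdiff d t (fun y => P (c * y + e) \Po (c *: 'X + e%:P)).
Proof.
move=> c0; elim: d t => [|d IHd] t /=.
  by rewrite expr0 invr1 mul1r horner_comp !hornerE.
rewrite (inj_eq (addIr _)) (inj_eq (mulfI c0)); case: ifP => [_|/negbT t_neq].
  rewrite nderivn_comp_affine hornerZ horner_comp !hornerE/=.
  by rewrite mulVf ?expf_neq0// mul1r.
have /= IHa := IHd (ascending t 1).
rewrite IHd [germ_divdiff d (ascending _ 1) P]IHa exprS.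
have c0d := expf_neq0 d c0.
have -> : c * t d.+1 + e - (c * t 0 + e) = c * (t d.+1 - t 0) by ring.
by field; rewrite c0 c0d subr_eq0 eq_sym t_neq.
Qed.

(** The defining recurrence, cleared of its denominator, survives when all
    knots coincide: both sides are then 0. *)
Lemma germ_divdiff_rec d t P :
  (forall i j, (i <= j <= d.+1)%N -> t i <= t j) ->
  (t d.+1 - t 0%N) * germ_divdiff d.+1 t P
  = germ_divdiff d (ascending t 1) P - germ_divdiff d t P.
Proof.
move=> t_le /=; case: eqVneq => [t0d|t_neq]; last first.
  by rewrite mulrC divfK// subr_eq0 eq_sym.
have tE i : (i <= d.+1)%N -> t i = t 0%N.
  by move=> id; apply: le_anti; rewrite {1}t0d !t_le// leqnn id.
rewrite (@eq_germ_divdiff d (ascending t 1) t P P).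
- by rewrite -t0d !subrr mul0r.
- by move=> i id; rewrite /ascending !tE// ltnW.
- by [].
Qed.

(** The Leibniz rule in the only case needed: multiplication by a linear factor
    that vanishes at the last knot removes that knot. Together with Euclidean
    division by such factors it evaluates divided differences of polynomials by
    induction on the number of knots. *)
Lemma germ_divdiff_mulXsubC d t P :
  (forall i j, (i <= j <= d.+1)%N -> t i <= t j) ->
  germ_divdiff d.+1 t (fun y => ('X - (t d.+1)%:P) * P y) = germ_divdiff d t P.
Proof.
elim: d t => [|d IHd] t t_le; rewrite [LHS]germ_divdiffS.
  case: eqVneq => [<-|t_neq]; first by rewrite horner_nderivnXsubCM nderivn0.
  rewrite /= /ascending addn0 !hornerM !hornerE /= subrr mul0r sub0r -mulNr opprB.
  by rewrite mulrAC mulfV ?mul1r// subr_eq0 eq_sym.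
case: eqVneq => [t0d|t_neq].
  rewrite -t0d horner_nderivnXsubCM.
  have tE i : (i <= d.+2)%N -> t i = t 0%N.
    by move=> id; apply: le_anti; rewrite {1}t0d !t_le ?id ?leqnn.
  by rewrite /= tE ?leqnSn// eqxx.
have t_le1 i j : (i <= j <= d.+1)%N -> ascending t 1 i <= ascending t 1 j.
  by move=> ij; apply: t_le; rewrite !add1n.
have t_le0 i j : (i <= j <= d.+1)%N -> t i <= t j.
  by move=> /andP[ij jd]; apply: t_le; rewrite ij ltnW.
have IH1 := IHd _ t_le1; rewrite {2}/ascending add1n in IH1; rewrite IH1.
rewrite (@eq_germ_divdiff d.+1 t t (fun y => ('X - (t d.+2)%:P) * P y)
  (fun y => (t d.+1 - t d.+2) *: P y + ('X - (t d.+1)%:P) * P y))//; last first.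
  by move=> i _; rewrite -mul_polyC polyCB; ring.
rewrite germ_divdiff_lin (IHd _ t_le0).
have rec := germ_divdiff_rec P t_le0.
rewrite (_ : germ_divdiff d (ascending t 1) P
  = (t d.+1 - t 0) * germ_divdiff d.+1 t P + germ_divdiff d t P); last first.
  by rewrite rec subrK.
have ? : t d.+2 - t 0 != 0 by rewrite subr_eq0 eq_sym.
by field.
Qed.

Lemma germ_divdiff_low d t (p : {poly R}) :
  (forall i j, (i <= j <= d)%N -> t i <= t j) ->
  (size p <= d)%N -> germ_divdiff d t (fun=> p) = 0.
Proof.
elim: d t p => [|d IHd] t p t_le.
  by rewrite leqn0 size_poly_eq0 => /eqP->; rewrite germ_divdiff0.
have divdiffC a d' t' : germ_divdiff d'.+1 t' (fun=> a%:P) = 0.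
  elim: d' t' => [|d' IH] t'.
    by rewrite /= nderivnC /= !hornerE subrr mul0r if_same.
  by rewrite germ_divdiffS nderivnC horner0 !IH subrr mul0r if_same.
move=> size_p.
have /factor_theorem[q pE] : root (p - p.[t d.+1]%:P) (t d.+1).
  by rewrite /root !hornerE subrr.
rewrite (@eq_germ_divdiff d.+1 t t (fun=> p)
   (fun=> 1 *: (('X - (t d.+1)%:P) * q) + p.[t d.+1]%:P))//; last first.
  by move=> _ _; rewrite scale1r mulrC -pE subrK.
rewrite germ_divdiff_lin mul1r divdiffC addr0 germ_divdiff_mulXsubC//.
apply: IHd => [i j /andP[ij jd]|]; first by rewrite t_le// ij ltnW.
have [->|q0] := eqVneq q 0; first by rewrite size_poly0.
have : (size (q * ('X - (t d.+1)%:P))%R <= d.+1)%N.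
  rewrite -pE (leq_trans (size_polyD _ _))// geq_max size_p size_polyN.
  by rewrite (leq_trans (size_polyC_leq1 _)).
by rewrite size_Mmonic ?monicXsubC// size_XsubC addn2.
Qed.

Lemma germ_divdiff_Xn d t :
  (forall i j, (i <= j <= d)%N -> t i <= t j) ->
  germ_divdiff d t (fun=> 'X^d) = 1.
Proof.
elim: d t => [|d IHd] t t_le; first by rewrite /= expr0 hornerC.
rewrite (@eq_germ_divdiff d.+1 t t (fun=> 'X^(d.+1))
   (fun=> t d.+1 *: 'X^d + ('X - (t d.+1)%:P) * 'X^d))//; last first.
  by move=> _ _; rewrite mulrBl mul_polyC addrC subrK exprS.
rewrite germ_divdiff_lin germ_divdiff_low ?size_polyXn// mulr0 add0r.
rewrite germ_divdiff_mulXsubC// IHd// => i j /andP[ij jd].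
by rewrite t_le// ij ltnW.
Qed.

End germ.

Section bridge.
Variable R : realType.

Lemma derive1n_horner (p : {poly R}) n :
  derive1n n (horner p) = horner p^`(n).
Proof.
by elim: n => [|n IHn]; rewrite ?derivn0// derive1nS IHn derivnS derivE.
Qed.

Lemma near_derive1n_horner (g : R -> R) (p : {poly R}) (a : R) n :
  (\forall y \near a, g y = p.[y]) ->
  \forall y \near a, derive1n n g y = p^`(n).[y].
Proof.
move=> gp; elim: n => [|n IHn]; first by rewrite derivn0.
have /near_join := IHn; apply: filterS => y gy.
rewrite derive1nS derivnS derivE !derive1E.
exact: near_eq_derive.
Qed.

(** The derivative in a divided difference at a multiple knot depends on the
    function near that knot only. *)
Lemma divdiff_germ d (t : nat -> R) g (P : R -> {poly R}) :
  (forall i, (i <= d)%N -> \forall y \near t i, g y = (P (t i)).[y]) ->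
  divdiff d t g = germ_divdiff d t P.
Proof.
elim: d t => [|d IHd] t gP; first exact: nbhs_singleton (gP 0%N _).
rewrite germ_divdiffS [LHS]/=; case: ifP => _.
  have /nbhs_singleton /= -> := near_derive1n_horner d.+1 (gP 0%N (leq0n _)).
  by rewrite nderivnE hornerZ mulrC.
congr ((_ - _) / _); apply: IHd => i id; first exact: gP.
by apply: gP; rewrite ltnW.
Qed.

Lemma divdiff_horner d (t : nat -> R) (p : {poly R}) :
  divdiff d t (horner p) = germ_divdiff d t (fun=> p).
Proof. by apply: divdiff_germ => i _; apply: filterE. Qed.

Lemma divdiff_monomial d (t : nat -> R) e :
  divdiff d t (fun x => x ^+ e) = germ_divdiff d t (fun=> 'X^e).
Proof.
rewrite -divdiff_horner; congr divdiff.
by apply/funext => x; rewrite hornerXn.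
Qed.

End bridge.

(** * Invertibility of the reproduction matrix *)

(** Alternation along [m.+1] increasing indices; [sg] carries the sign of the
    first of the values. *)
Definition sign_changes (R : realType) (c : nat -> R) (m : nat) : Prop :=
  exists (e : nat -> nat) (sg : R),
    (forall p, (p < m)%N -> (e p < e p.+1)%N) /\
    (forall p, (p <= m)%N -> 0 < sg * (-1) ^+ p * c (e p)).

Section sign.
Variable R : realType.
Implicit Types (c t : nat -> R).

Lemma partial_sums_eq0 c N :
  \sum_(i < N) c i = 0 -> (forall j, (N <= j)%N -> c j = 0) ->
  forall j, (N <= j)%N -> \sum_(i < j) c i = 0.
Proof.
move=> sum0 cN; elim=> [|j IHj]; first by rewrite leqn0 => /eqP N0; rewrite -N0.
rewrite leq_eqVlt => /predU1P[<- //|Nj].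
by rewrite big_ord_recr /= IHj// cN// addr0.
Qed.

(** Discrete Rolle theorem: the partial sums start at 0 and end at 0, so
    before, between and after [m + 1] indices at which they alternate in sign
    they must move in [m + 2] alternating directions, and a move of the partial
    sums over a block of indices needs a term of the same sign in it. *)
Lemma sign_changes_partial_sums c m N :
  \sum_(i < N) c i = 0 -> (forall j, (N <= j)%N -> c j = 0) ->
  sign_changes (fun j => \sum_(i < j) c i) m -> sign_changes c m.+1.
Proof.
move=> sum0 cN [e [sg [e_incr e_pos]]].
pose D j := \sum_(i < j) c i.
have DN : forall j, (N <= j)%N -> D j = 0 := partial_sums_eq0 sum0 cN.
(* Consecutive values of [E] delimit the blocks of terms, from 0 to [N]. *)
pose E p := if p is p'.+1 then if (p' <= m)%N then e p' else N else 0%N.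
have Ele p : (p <= m)%N -> E p.+1 = e p by rewrite /E => ->.
have step p : (p <= m.+1)%N ->
    exists i, (E p <= i < E p.+1)%N /\ 0 < sg * (-1) ^+ p * c i.
  move=> pm.
  have DE1 : 0 <= sg * (-1) ^+ p * D (E p.+1).
    rewrite /E; case: leqP => [/e_pos/ltW //|mp].
    by rewrite DN// mulr0.
  have DDpos : 0 < sg * (-1) ^+ p * (D (E p.+1) - D (E p)).
    rewrite mulrBr subr_gt0.
    case: p pm DE1 => [|p] pm DE1.
      rewrite {1}/D big_ord0 mulr0 /=; exact: e_pos.
    apply: lt_le_trans DE1; rewrite Ele// exprS mulN1r mulrN mulNr.
    by rewrite oppr_lt0; exact: e_pos.
  have Eincr : (E p <= E p.+1)%N.
    case: p pm {DE1 DDpos} => [//|p] pm; rewrite Ele// /E.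
    case: (leqP p.+1 m) => [pm'|mp]; first by apply: ltnW; apply: e_incr.
    rewrite leqNgt; apply/negP => /ltnW/DN De.
    by have := e_pos p pm; rewrite -/(D _) De mulr0 ltxx.
  apply: contrapT => noi; move: DDpos; apply/negP; rewrite -leNgt.
  rewrite /D -!(big_mkord xpredT c) (big_cat_nat (leq0n _) Eincr)/=.
  rewrite [_ + _ - _]addrAC subrr add0r mulr_sumr big_nat_cond.
  apply: sumr_le0 => i /andP[Ei _].
  by rewrite leNgt; apply/negP => ci; apply: noi; exists i.
have /choice[e' e'P] : forall p, exists i, (p <= m.+1)%N ->
    (E p <= i < E p.+1)%N /\ 0 < sg * (-1) ^+ p * c i.
  move=> p; have [/step[i ?]|_] := boolP (p <= m.+1)%N; first by exists i.
  by exists 0%N.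
exists e', sg; split => p pm; last by have [] := e'P _ pm.
have [/andP[_ lt1] _] := e'P _ (ltnW pm).
have [/andP[le2 _] _] := e'P _ pm.
exact: leq_trans lt1 le2.
Qed.

(** A nontrivial combination of divided differences of order [k.+1] that
    annihilates [r] further powers has at least [r] sign changes. The power of
    degree [k.+1] says that the coefficients sum to 0; summation by parts then
    rewrites the combination through divided differences of order [k.+2], whose
    coefficients are the partial sums times the nonnegative lengths
    [t (j + k.+2) - t j]. These have one sign change less and annihilate
    one power less. *)
Lemma sign_changes_annihilator t r k c N :
  {homo t : i j / (i <= j)%N >-> i <= j} ->
  (forall j, (N <= j)%N -> c j = 0) -> (exists j, c j != 0) ->
  (forall j, c j != 0 -> t j < t (j + k + 1)%N) ->
  (forall d, (d < r)%N ->
     \sum_(j < N) c j * germ_divdiff k.+1 (ascending t j)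
                         (fun=> 'X^(k + 1 + d)) = 0) ->
  sign_changes c r.
Proof.
move=> t_le; elim: r k c N => [|r IHr] k c N cN [j0 cj0] c_lt c_ann.
  exists (fun=> j0), (c j0); split => // p; rewrite leqn0 => /eqP->.
  by rewrite expr0 mulr1 -expr2 exprn_even_gt0.
have asc_le i a b : (a <= b)%N -> ascending t i a <= ascending t i b.
  by move=> ab; apply: t_le; rewrite leq_add2l.
pose D j := \sum_(i < j) c i.
have DN : D N = 0.
  rewrite -[RHS](c_ann 0%N)//; apply: eq_bigr => j _.
  by rewrite addn0 addn1 germ_divdiff_Xn ?mulr1// => a b /andP[ab _]; apply: asc_le.
pose d j := D j.+1 * (t (j + k.+2)%N - t j).
have D_supp : forall j, (N <= j)%N -> D j = 0 := partial_sums_eq0 DN cN.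
apply: (@sign_changes_partial_sums c r N) => //; rewrite -/D.
have [e [sg [e_incr e_pos]]] : sign_changes d r.
  apply: (IHr k.+1 d N).
  - by move=> j Nj; rewrite /d D_supp ?mul0r// ltnW.
  (* At the first nonzero coefficient the partial sum equals that coefficient,
     and the length is positive because its knots are not all equal. *)
  - have ex : exists j, c j != 0 by exists j0.
    exists (ex_minn ex); case: ex_minnP => j cj jmin.
    rewrite /d mulf_neq0//.
      rewrite /D big_ord_recr /= big1 ?add0r// => i _.
      apply: contraTeq (ltn_ord i) => ci; rewrite -leqNgt; exact: jmin.
    rewrite subr_eq0 gt_eqF// (lt_le_trans (c_lt _ cj))// t_le//.
    by rewrite -addnA leq_add2l addn1.
  - move=> j; rewrite /d mulf_eq0 negb_or subr_eq0 => /andP[_ tj].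
    rewrite lt_neqAle eq_sym.
    have -> : (j + k.+1 + 1 = j + k.+2)%N by lia.
    by rewrite tj t_le// leq_addr.
  - move=> a ar.
    have := c_ann a.+1 ar.
    set F := fun j => germ_divdiff k.+1 (ascending t j) (fun=> 'X^(k + 1 + a.+1)).
    have dF j : d j * germ_divdiff k.+2 (ascending t j)
        (fun=> 'X^(k.+1 + 1 + a)) = D j.+1 * (F j.+1 - F j).
      rewrite /d -mulrA; congr (_ * _).
      have -> : (k.+1 + 1 + a = k + 1 + a.+1)%N by lia.
      have -> : t (j + k.+2)%N - t j = ascending t j k.+2 - ascending t j 0.
        by rewrite /ascending addn0.
      rewrite germ_divdiff_rec; last by move=> p q /andP[pq _]; apply: asc_le.
      congr (_ - _); apply: eq_germ_divdiff => // i _.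
      by rewrite /ascending addnA addn1.
    under [X in _ -> X = _]eq_bigr do rewrite dF.
    suff abel n : \sum_(j < n) c j * F j
        = D n * F n - \sum_(j < n) D j.+1 * (F j.+1 - F j).
      by rewrite abel DN mul0r sub0r => /eqP; rewrite oppr_eq0 => /eqP.
    elim: n => [|n IHn]; first by rewrite !big_ord0 /D big_ord0 mul0r subr0.
    rewrite !big_ord_recr /= IHn /D big_ord_recr /=; ring.
exists (fun p => (e p).+1), sg; split=> [p pr|p pr]; first exact: e_incr.
have := e_pos p pr; rewrite /d mulrA => pos.
rewrite ltNge; apply/negP => npos; move: pos; apply/negP; rewrite -leNgt.
by rewrite mulr_le0_ge0// subr_ge0 t_le// leq_addr.
Qed.
End sign.

Section reproduction.
Variable R : realType.

Lemma index_le_max r (J : 'I_r.+1 -> nat) :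
  (forall p q : 'I_r.+1, (p < q)%N -> (J p < J q)%N) ->
  forall q, (J q <= J ord_max)%N.
Proof.
move=> Jincr q.
have := leq_ord q; rewrite leq_eqVlt => /predU1P[qr|/(Jincr q ord_max)/ltnW//].
by rewrite (_ : q = ord_max)//; apply: val_inj.
Qed.

(** A vector in the kernel of the matrix gives a combination of [r.+1] divided
    differences that annihilates [r.+1] powers. If it were nonzero it would
    have [r.+1] sign changes, hence [r.+2] nonzero coefficients. *)
Lemma reproduction_mx_unit k r (J : 'I_r.+1 -> nat) (t : nat -> R) :
  (forall p q : 'I_r.+1, (p < q)%N -> (J p < J q)%N) ->
  (forall p q : nat, (p <= q <= J ord_max + k + 1)%N -> t p <= t q) ->
  (forall q : 'I_r.+1, t (J q) <> t (J q + k + 1)%N) ->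
  reproduction_mx k J t \in unitmx.
Proof.
move=> Jincr t_le t_neq.
have Jle := index_le_max Jincr.
have Jinj : injective J.
  by move=> p q Jpq; apply: val_inj; case: (ltngtP p q) => //= /Jincr;
     rewrite Jpq ltnn.
set n := (J ord_max + k + 1)%N in t_le.
(* Freezing the knots after the last one makes the sequence monotone on nat. *)
pose T i := t (minn i n).
have T_le : {homo T : i j / (i <= j)%N >-> i <= j}.
  by move=> i j ij; apply: t_le; rewrite geq_minr andbT leq_min geq_minr
     (leq_trans (geq_minl _ _)).
rewrite -unitmx_tr unitmxE unitfE; apply/negP => /det0P[v v0 vM].
pose c j := \sum_(q | J q == j) v 0 q.
have cJ q : c (J q) = v 0 q.
  by rewrite /c (eq_bigl (pred1 q)) ?big_pred1_eq// => p; rewrite (inj_eq Jinj).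
have c_supp j : c j != 0 -> exists q, J q = j.
  apply: contraPP => noq; apply/negP; rewrite negbK /c big_pred0// => q.
  by apply/eqP => Jq; apply: noq; exists q.
have : sign_changes c r.+1.
  apply: (@sign_changes_annihilator R T r.+1 k c (J ord_max).+1) => //.
  - move=> j Jj; apply/eqP; apply: contraTT Jj => /c_supp[q <-].
    by rewrite -leqNgt.
  - apply: contrapT => c0; move/negP: v0; apply; apply/eqP/rowP => q.
    rewrite -cJ mxE; apply/eqP/negPn/negP => cq.
    by apply: c0; exists (J q).
  - move=> j /c_supp[q <-].
    have Jn : (J q + k + 1 <= n)%N by rewrite !leq_add2r.
    rewrite /T (minn_idPl _) ?(minn_idPl Jn); last first.
      by rewrite (leq_trans _ Jn)// -addnA leq_addr.
    rewrite lt_neqAle t_le ?Jn ?andbT; first exact/eqP.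
    by rewrite -addnA leq_addr.
  - move=> d dr; have /rowP/(_ (Ordinal dr)) := vM.
    rewrite mxE [RHS]mxE => vMd; rewrite -[RHS]vMd.
    transitivity (\sum_(j < (J ord_max).+1) \sum_q
        (if J q == j then v 0 q * germ_divdiff k.+1 (ascending T j)
                                    (fun=> 'X^(k + 1 + d)) else 0)).
      by apply: eq_bigr => j _; rewrite /c mulr_suml -big_mkcond.
    rewrite exchange_big; apply: eq_bigr => q _; rewrite -big_mkcond.
    have JqN : (J q < (J ord_max).+1)%N by rewrite ltnS.
    rewrite (big_pred1 (Ordinal JqN)); last by move=> j; rewrite eq_sym.
    rewrite !mxE divdiff_monomial; congr (_ * _).
    apply: eq_germ_divdiff => // i ik; rewrite /ascending /T /= (minn_idPl _)//.
    by have := Jle q; rewrite /n; lia.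
move=> [e [sg [e_incr e_pos]]].
have /choice[q qe] (p : 'I_r.+2) : exists q, J q = e p.
  apply: c_supp; apply/eqP => ce; have := e_pos p (leq_ord p).
  by rewrite ce mulr0 ltxx.
have e_lt i j : (i < j)%N -> (j <= r.+1)%N -> (e i < e j)%N.
  elim: j => // j IHj; rewrite ltnS leq_eqVlt => /predU1P[->|ij] jr.
    exact: e_incr.
  by rewrite (ltn_trans (IHj ij (ltnW jr)))// e_incr.
have : injective q.
  move=> i j qij; have : e i = e j by rewrite -!qe qij.
  move=> eij; apply: val_inj; case: (ltngtP i j) => // ij.
  - by have := e_lt i j ij (leq_ord j); rewrite eij ltnn.
  - by have := e_lt j i ij (leq_ord i); rewrite eij ltnn.
by move/leq_card; rewrite !card_ord ltnn.
Qed.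
End reproduction.

(** * B-splines through polynomial germs *)

Definition truncpow_germ (R : realType) (k : nat) (x y : R) : {poly R} :=
  if x < y then ('X - x%:P) ^+ k else 0.

(** The everywhere defined version of the B-spline, equal to it off the knots. *)
Definition bspline_germ (R : realType) (k : nat) (t : nat -> R) (x : R) : R :=
  k.+1%:R * germ_divdiff k.+1 t (truncpow_germ k x).

Section bspline.
Variable R : realType.
Implicit Types (k : nat) (t : nat -> R).

Lemma truncpow_near k (x y : R) : x != y ->
  \forall z \near y, truncpow k x z = (truncpow_germ k x y).[z].
Proof.
rewrite /truncpow_germ; case: ltgtP => // xy _.
  have : \forall z \near y, - z < - x by apply: Nlt_nbhsl; rewrite ltrN2.
  apply: filterS => z; rewrite ltrN2 => /ltW xz; by rewrite /truncpow xz !hornerE.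
have : \forall z \near y, z < x by exact: lt_nbhsl.
by apply: filterS => z zx; rewrite /truncpow leNgt zx /= horner0.
Qed.

Lemma bspline_off_knots k t x :
  (forall i, (i <= k.+1)%N -> x != t i) -> bspline k t x = bspline_germ k t x.
Proof.
move=> xt; congr (_ * _); apply: divdiff_germ => i ik.
by apply: truncpow_near; exact: xt.
Qed.

Lemma comp_XsubC_exp k (x : R) (q : {poly R}) :
  ('X - x%:P) ^+ k \Po q = (q - x%:P) ^+ k.
Proof.
elim: k => [|k IHk]; first by rewrite !expr0 comp_polyC.
by rewrite !exprS comp_polyM IHk comp_polyB comp_polyX comp_polyC.
Qed.

(** To the right of the knots all germs vanish; to the left of them they are one
    and the same polynomial of degree [k], which a divided difference of order
    [k.+1] kills. *)
Lemma bspline_germ_support k t x :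
  (forall i j, (i <= j <= k.+1)%N -> t i <= t j) ->
  bspline_germ k t x != 0 -> t 0%N <= x <= t k.+1.
Proof.
move=> t_le; rewrite /bspline_germ mulf_eq0 negb_or => /andP[_].
apply: contraR; rewrite negb_and -!ltNge => /orP[xt0|tx].
  rewrite (@eq_germ_divdiff R k.+1 t t _ (fun=> ('X - x%:P) ^+ k))//.
    by rewrite germ_divdiff_low// size_exp_XsubC.
  by move=> i ik; rewrite /truncpow_germ (lt_le_trans xt0)// t_le// ik.
rewrite (@eq_germ_divdiff R k.+1 t t _ (fun=> 0)) ?germ_divdiff0// => i ik.
by rewrite /truncpow_germ ltNge ltW// (le_lt_trans _ tx)// t_le// ik leqnn.
Qed.

Lemma eq_bspline_germ k t t' x :
  (forall i, (i <= k.+1)%N -> t i = t' i) ->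
  bspline_germ k t x = bspline_germ k t' x.
Proof. by move=> tt'; congr (_ * _); apply: eq_germ_divdiff. Qed.

Lemma bspline_germ_affine k t (h e x : R) : 0 < h ->
  bspline_germ k (fun l => h * t l + e) (h * x + e)
  = h^-1 * bspline_germ k t x.
Proof.
move=> h0; have hn0 := lt0r_neq0 h0.
rewrite /bspline_germ germ_divdiff_affine//.
rewrite (@eq_germ_divdiff R k.+1 t t _ (fun y => h ^+ k *: truncpow_germ k x y)).
- rewrite germ_divdiffZ exprS.
  by field; rewrite hn0 expf_neq0.
- by [].
- move=> i _; rewrite /truncpow_germ ltrD2r ltr_pM2l//.
  case: ifP => _; last by rewrite comp_poly0 scaler0.
  rewrite comp_XsubC_exp -exprZn; congr (_ ^+ _).
  by rewrite polyCD polyCM scalerBr -!mul_polyC; ring.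
Qed.

(** Up to sign, reflection exchanges the two one-sided truncated powers, and
    these differ by a polynomial of degree [k], which the divided difference
    kills. *)
Lemma bspline_germ_reflect k t (e x : R) :
  (forall i j, (i <= j <= k.+1)%N -> t i <= t j) ->
  (forall i, (i <= k.+1)%N -> x != t i) ->
  bspline_germ k (fun l => e - t (k.+1 - l)%N) (e - x) = bspline_germ k t x.
Proof.
move=> t_le xt; congr (_ * _).
have n1 : (-1 : R) != 0 by rewrite oppr_eq0 oner_eq0.
pose t' l := -1 * t l + e.
rewrite (@eq_germ_divdiff R k.+1 _ (fun l => t' (k.+1 - l)%N) _
  (truncpow_germ k (e - x)))//; last by move=> i _; rewrite /t' mulN1r addrC.
rewrite germ_divdiff_rev germ_divdiff_affine//.
rewrite (@eq_germ_divdiff R k.+1 t t _ (fun y => (-1) ^+ k.+1 *: truncpow_germ k x y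
    + (-1) ^+ k *: ('X - x%:P) ^+ k))//; last first.
  move=> i ik; rewrite /truncpow_germ mulN1r [- t i + e]addrC ltrD2l ltrN2.
  have := xt i ik; case: ltgtP => //= _ _; last first.
    by rewrite comp_poly0 exprS mulN1r scaleNr addNr.
  rewrite scaler0 add0r comp_XsubC_exp -exprZn; congr (_ ^+ _).
  by rewrite polyCB -!mul_polyC polyCN polyC1; ring.
rewrite germ_divdiff_lin (@germ_divdiff_low _ _ _ ((-1) ^+ k *: _))//; last first.
  by rewrite (leq_trans (size_scale_leq _ _))// size_exp_XsubC.
by rewrite addr0 mulrA mulVf ?mul1r// expf_neq0.
Qed.

(** As a function of [x], the divided difference of the truncated power is a
    linear combination of truncated powers of degree at most [k], because at
    most [k.+1] of its knots coincide. A relation [Phi] between functions and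
    numbers that is stable under combinations can thus be checked on
    truncated powers, and then evaluates to a divided difference of [q]. *)
Lemma truncpow_divdiff_ind k t d (q : {poly R}) (Phi : (R -> R) -> R -> Prop) :
  (forall a f u g v, Phi f u -> Phi g v ->
     Phi (fun x => a * (f x - g x)) (a * (u - v))) ->
  (forall i e, (i <= d)%N -> (e <= k)%N ->
     Phi (fun x => (truncpow_germ k x (t i))^`N(e).[t i]) (q^`N(e).[t i])) ->
  (d <= k)%N || (d == k.+1) && (t 0%N != t d) ->
  Phi (fun x => germ_divdiff d t (truncpow_germ k x))
      (germ_divdiff d t (fun=> q)).
Proof.
move=> Phi_lin; elim: d t => [|d IHd] t Phi_base dk.
  have := Phi_base 0%N 0%N isT isT; rewrite nderivn0.
  by under eq_fun do rewrite nderivn0.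
have dk' : (d <= k)%N by case/orP: dk => [/ltnW//|/andP[/eqP[->]]].
have ind t' : (forall i, (i <= d)%N -> exists2 j, (j <= d.+1)%N & t' i = t j) ->
    Phi (fun x => germ_divdiff d t' (truncpow_germ k x))
        (germ_divdiff d t' (fun=> q)).
  move=> t'P; apply: IHd; last by rewrite dk'.
  by move=> i e /t'P[j jd ->]; apply: Phi_base.
under eq_fun do rewrite germ_divdiffS.
rewrite germ_divdiffS; have [t0d|t_neq] := eqVneq (t 0%N) (t d.+1).
  apply: Phi_base => //.
  by case/orP: dk => //; rewrite t0d eqxx andbF.
rewrite mulrC.
under eq_fun do rewrite mulrC.
apply: Phi_lin; apply: ind => i id; last by exists i => //; rewrite ltnW.
by exists (1 + i)%N.
Qed.

Lemma horner_nderivn_XsubC_exp k (x y : R) e :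
  (('X - x%:P) ^+ k)^`N(e).[y] = (y - x) ^+ (k - e) *+ 'C(k, e).
Proof.
have -> : ('X - x%:P) ^+ k = 'X^k \Po (1 *: 'X + (- x)%:P).
  by rewrite rmorphXn /= comp_polyX scale1r polyCN.
rewrite nderivn_comp_affine expr1n scale1r nderivnXn horner_comp.
by rewrite !hornerE hornerMn hornerXn.
Qed.

End bspline.

(** * Peano's formula for the moments of a B-spline *)

Section peano.
Variable R : realType.
Implicit Types (p q s : {poly R}) (a b y : R).
Local Notation mu := (@lebesgue_measure R).

(** Subtracting the Taylor polynomial at [a]. *)
Lemma taylor_remainder a m p : exists2 q,
  (size (p - q)%R <= m)%N & forall j, (j < m)%N -> q^`N(j).[a] = 0.
Proof.
elim: m => [|m [q size_q q0]]; first by exists p => //; rewrite subrr size_poly0.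
exists (q - q^`N(m).[a] *: ('X - a%:P) ^+ m) => [|j].
  rewrite opprB addrC -addrA (leq_trans (size_polyD _ _))// geq_max.
  rewrite (leq_trans (size_scale_leq _ _)) ?size_exp_XsubC//=.
  by rewrite addrC (leq_trans size_q).
rewrite ltnS leq_eqVlt nderivnB nderivnZ !hornerE horner_nderivn_XsubC_exp.
move=> /predU1P[->|jm]; first by rewrite subnn binn expr0 mulr1 subrr.
by rewrite subrr expr0n subn_eq0 leqNgt jm mul0rn mulr0 subr0 q0.
Qed.

(** The sum telescopes under differentiation, which makes it an antiderivative
    of the integrand in the remainder of Taylor's formula. *)
Definition taylor_antideriv y s m : {poly R} :=
  \sum_(i < m.+1) i`!%:R^-1 *: ((y%:P - 'X) ^+ i * s^`(i)).

Lemma deriv_taylor_antideriv y s m :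
  (taylor_antideriv y s m)^`() = m`!%:R^-1 *: ((y%:P - 'X) ^+ m * s^`(m.+1)).
Proof.
elim: m => [|m IHm].
  by rewrite /taylor_antideriv big_ord1 derivZ !expr0 !mul1r derivnS.
rewrite /taylor_antideriv big_ord_recr derivD -/(taylor_antideriv y s m) IHm /=.
rewrite derivZ derivM -derivnS deriv_exp derivB derivC derivX sub0r /=.
have -> : m`!%:R^-1 = (m.+1)`!%:R^-1 * m.+1%:R :> R.
  by rewrite factS natrM invfM mulrAC mulVf ?mul1r.
by rewrite -!mul_polyC polyCM polyC_natr; ring.
Qed.

Lemma Rintegral_deriv_poly a b p : a <= b ->
  Rintegral mu `[a, b] (horner p^`()) = p.[b] - p.[a].
Proof.
rewrite le_eqVlt => /predU1P[<-|ab].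
  by rewrite set_itv1 Rintegral_set1 subrr.
have cp q x : {for x, continuous (horner q)} by exact: continuous_horner.
rewrite /Rintegral (@continuous_FTC2 _ _ (horner p) _ _ ab)//.
- by apply: continuous_subspaceT => x; exact: cp.
- split.
  + by move=> x _; exact: derivable_horner.
  + by apply: cvg_at_right_filter; exact: cp.
  + by apply: cvg_at_left_filter; exact: cp.
- by move=> x _; rewrite derivE.
Qed.

(** Taylor's formula with integral remainder for the derivative of order [e] of
    [q], all of whose Taylor coefficients of degree at most [k] at [a] vanish. *)
Lemma Rintegral_taylor a y q k e : a <= y -> (e <= k)%N ->
  (forall j, (j < k.+1)%N -> q^`N(j).[a] = 0) ->
  Rintegral mu `[a, y] (fun x => (y - x) ^+ (k - e) *+ 'C(k, e)
                                 * (k`!%:R^-1 *: q^`(k.+1)).[x])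
  = q^`N(e).[y].
Proof.
move=> ay ek q0; pose m := (k - e)%N.
have fact_neq0 n : n`!%:R != 0 :> R by rewrite pnatr_eq0 -lt0n fact_gt0.
pose W := e`!%:R^-1 *: taylor_antideriv y q^`(e) m.
rewrite (_ : (fun x => _) = horner W^`()).
  rewrite Rintegral_deriv_poly// !hornerZ !horner_sum.
  rewrite big_ord_recl big1 ?addr0 => [|i _]; last first.
    rewrite hornerZ hornerM horner_exp hornerD hornerN hornerC hornerX subrr.
    by rewrite lift0 exprS !mul0r mulr0.
  rewrite big1 => [|i _].
    rewrite mulr0 subr0 nderivnE !hornerZ hornerM expr0 hornerC derivn0.
    by rewrite fact0 invr1 !mul1r.
  rewrite hornerZ hornerM (_ : _^`(i) = q^`(i + e)); last first.
    by rewrite /derivn iterD.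
  rewrite nderivn_def hornerMn q0 ?mul0rn ?mulr0//.
  by have := ltn_ord i; rewrite /m; lia.
apply/funext => x; rewrite derivZ deriv_taylor_antideriv.
rewrite (_ : q^`(e)^`(m.+1) = q^`(k.+1)); last first.
  by rewrite /derivn -iterD addSn subnK.
rewrite !hornerZ hornerM horner_exp hornerD hornerN hornerC hornerX -mulr_natr.
rewrite -/m -(bin_fact ek) -/m !natrM.
have := fact_neq0 m; have := fact_neq0 e.
have : 'C(k, e)%:R != 0 :> R by rewrite pnatr_eq0 -lt0n bin_gt0.
by move=> bin_neq0 fe fm; field; rewrite bin_neq0 fe fm.
Qed.
End peano.

Section moments.
Variable R : realType.
Local Notation mu := (@lebesgue_measure R).

Lemma integrable_bounded_horner (f : R -> R) (p : {poly R}) a b C :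
  measurable_fun setT f -> (forall x, a <= x <= b -> `|f x| <= C) ->
  mu.-integrable `[a, b] (EFin \o (fun x => f x * p.[x])).
Proof.
move=> mf fC.
have ip : mu.-integrable `[a, b] (EFin \o horner p).
  apply: continuous_compact_integrable; first exact: segment_compact.
  by apply: continuous_subspaceT => x; exact: continuous_horner.
apply: (@integrableMr _ _ _ mu `[a, b]%classic _ f (EFin \o horner p)) => //.
  exact: measurable_funTS.
exists C; split; first exact: num_real.
by move=> M CM x; rewrite /= in_itv/= => xab; rewrite (le_trans (fC _ xab))// ltW.
Qed.

Lemma truncpow_divdiff_moment k d (t : nat -> R) (q : {poly R}) a b :
  (forall i, (i <= d)%N -> a <= t i <= b) ->
  (d <= k)%N || (d == k.+1) && (t 0%N != t d) ->
  (forall j, (j < k.+1)%N -> q^`N(j).[a] = 0) ->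
  [/\ measurable_fun setT (fun x => germ_divdiff d t (truncpow_germ k x)),
      exists C, forall x, a <= x <= b ->
        `|germ_divdiff d t (truncpow_germ k x)| <= C &
      Rintegral mu `[a, b] (fun x => germ_divdiff d t (truncpow_germ k x)
                                     * (k`!%:R^-1 *: q^`(k.+1)).[x])
      = germ_divdiff d t (fun=> q)].
Proof.
move=> tab dk q0; set g := _ *: _.
pose Phi (f : R -> R) (v : R) := [/\ measurable_fun setT f,
  exists C, forall x, a <= x <= b -> `|f x| <= C &
  Rintegral mu `[a, b] (fun x => f x * g.[x]) = v].
apply: (@truncpow_divdiff_ind R k t d q Phi) => //.
  move=> c f u h v [mf [C fC] fu] [mh [D hD] hv]; split.
  - by apply: measurable_funM => //; apply: measurable_funB.
  - exists (`|c| * (C + D)) => x xab; rewrite normrM ler_wpM2l//.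
    by rewrite (le_trans (ler_normB _ _))// lerD ?fC ?hD.
  - have intf := integrable_bounded_horner g mf fC.
    have inth := integrable_bounded_horner g mh hD.
    rewrite -fu -hv -RintegralB// -RintegralZl//; last exact: (integrableB _ intf inth).
    by apply: eq_Rintegral => x _; rewrite -mulrBl mulrA.
move=> i e id ek; set y := t i.
have /andP[ay yb] := tab i id.
pose F x := (y - x) ^+ (k - e) *+ 'C(k, e).
have germE x : (truncpow_germ k x y)^`N(e).[y] = if x < y then F x else 0.
  rewrite /truncpow_germ; case: ifP => _; first exact: horner_nderivn_XsubC_exp.
  by rewrite nderivn_poly0 ?size_poly0// horner0.
have FE : F = horner ((y%:P - 'X) ^+ (k - e) *+ 'C(k, e)).
  by apply/funext => x; rewrite hornerMn horner_exp hornerD hornerN hornerC hornerX.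
have mF A : measurable_fun A F by rewrite FE; exact: measurable_poly.
split.
- under eq_fun do rewrite germE.
  apply: measurable_fun_ifT => //.
  by apply: measurable_fun_ltr.
- exists ((b - a) ^+ (k - e) *+ 'C(k, e)) => x /andP[ax xb].
  rewrite germE; have ba : 0 <= b - a by rewrite subr_ge0 (le_trans ax).
  case: ifP => xy; last by rewrite normr0 mulrn_wge0// exprn_ge0.
  have yx : 0 <= y - x by rewrite subr_ge0 ltW.
  rewrite /F ger0_norm ?mulrn_wge0 ?exprn_ge0// ler_wMn2r//.
  by rewrite lerXn2r ?nnegrE// lerB.
- rewrite -(Rintegral_taylor ay ek q0) -/g -/F.
  rewrite (_ : (fun x => _)
      = fun x => ((fun x => F x * g.[x]) \_ `]-oo, y[) x); last first.
    apply/funext => x; rewrite germE /patch mem_setE in_itv /=.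
    by case: ifP => // _; rewrite mul0r.
  rewrite -Rintegral_mkcondr.
  have -> : `[a, b] `&` `]-oo, y[ = `[a, y[%classic.
    apply/seteqP; split=> x /=; rewrite !in_itv /=.
      by move=> [/andP[-> _]].
    by move=> /andP[-> xy]; rewrite xy; split=> //; rewrite ltW// (lt_le_trans xy).
  apply: Rintegral_itv_bndo_bndc.
  apply: (@integrableS _ _ _ mu `[a, y]%classic) => //.
    by apply: subset_itvl; rewrite bnd_simp.
  set p := _ *+ _ in FE.
  rewrite (_ : (fun x => F x * g.[x]) = horner (p * g)); last first.
    by apply/funext => x; rewrite FE hornerM.
  apply: continuous_compact_integrable; first exact: segment_compact.
  by apply: continuous_subspaceT => x; exact: continuous_horner.
Qed.

(** Peano's formula: a B-spline is the kernel that represents the divided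
    difference. The divided difference of order [k.+1] ignores the Taylor
    polynomial of degree [k] at the first knot, so Taylor's formula for the
    remainder, integrated against each truncated power, gives the value.
    Measurability and boundedness come out of the same induction. *)
Lemma bspline_germ_moment k (t : nat -> R) (p : {poly R}) :
  (forall i j, (i <= j <= k.+1)%N -> t i <= t j) -> t 0%N != t k.+1 ->
  [/\ measurable_fun setT (bspline_germ k t),
      exists C, forall x, `|bspline_germ k t x| <= C &
      Rintegral mu setT (fun x => bspline_germ k t x * (p^`N(k.+1)).[x])
      = germ_divdiff k.+1 t (fun=> p)].
Proof.
move=> t_le t_neq.
have [q size_pq q0] := taylor_remainder (t 0%N) k.+1 p.
have tab i : (i <= k.+1)%N -> t 0%N <= t i <= t k.+1.
  by move=> ik; rewrite !t_le// ?ik ?leqnn.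
have [] := @truncpow_divdiff_moment k k.+1 t q _ _ tab _ q0.
  by rewrite eqxx t_neq orbT.
move=> mD [C DC] intD; split.
- exact: measurable_funM.
- exists (k.+1%:R * C) => x.
  have [B0|/(bspline_germ_support t_le) xab] := eqVneq (bspline_germ k t x) 0.
    rewrite B0 normr0 mulr_ge0// (le_trans _ (DC (t 0%N) _))//.
    by rewrite lexx/= t_le// leqnn.
  by rewrite /bspline_germ normrM normr_nat ler_wpM2l// DC.
have -> : germ_divdiff k.+1 t (fun=> p) = germ_divdiff k.+1 t (fun=> q).
  rewrite (@eq_germ_divdiff R k.+1 t t (fun=> p) (fun=> 1 *: q + (p - q)))//.
    by rewrite germ_divdiff_lin mul1r (germ_divdiff_low t_le size_pq) addr0.
  by move=> _ _; rewrite scale1r addrC subrK.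
have pq : p^`(k.+1) = q^`(k.+1).
  by apply/eqP; rewrite -subr_eq0 -derivnB derivn_poly0.
rewrite -intD [RHS]Rintegral_mkcond; apply: eq_Rintegral => x _.
rewrite /patch mem_setE in_itv; case: ifPn => xab; last first.
  suff -> : bspline_germ k t x = 0 by rewrite mul0r.
  by apply: contraNeq xab; exact: bspline_germ_support.
rewrite nderivnE pq !hornerZ /bspline_germ factS natrM invfM.
have ? : k.+1%:R != 0 :> R by rewrite pnatr_eq0.
have ? : k`!%:R != 0 :> R by rewrite pnatr_eq0 -lt0n fact_gt0.
by field; apply/andP.
Qed.
End moments.

(** * Lebesgue integrals: exceptional points and affine substitution *)

Section lebesgue_affine.
Variable R : realType.
Local Notation mu := (@lebesgue_measure R).

Lemma integral_finite_modification (f g : R -> R) (l : seq R) :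
  (forall x, x \notin l -> f x = g x) -> mu.-integrable setT (EFin \o g) ->
  mu.-integrable setT (EFin \o f) /\ Rintegral mu setT f = Rintegral mu setT g.
Proof.
move=> fg ig.
pose N := [set` l].
have cN : countable N by apply/finite_set_countable/finite_seq.
have mN : measurable N by apply: countable_measurable => //; exact: measurable_set1.
have N0 : mu N = 0 by exact: countable_lebesgue_measure0.
have mg : measurable_fun setT g by apply/measurable_EFinP; exact: measurable_int ig.
have mf : measurable_fun setT f.
  rewrite -(setUv N); apply/measurable_funU => //; first exact: measurableC.
  split.
    move=> _ Y mY; apply: countable_measurable; first exact: measurable_set1.
    by apply: sub_countable cN; exact: subset_card_le.
  apply: (eq_measurable_fun g); last exact: measurable_funTS.
  by move=> x; rewrite inE /N /= => /negP/fg.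
have fgN : {in setT `\` N, (EFin \o g) =1 (EFin \o f)}.
  by move=> x; rewrite inE /N => -[_ /= /negP/fg ->].
have mf' : measurable_fun setT (EFin \o f) by exact/measurable_EFinP.
have mg' : measurable_fun setT (EFin \o g) by exact/measurable_EFinP.
have if_ : mu.-integrable setT (EFin \o f).
  apply: (proj2 (@negligible_integrable _ _ _ mu _ _ _ mN measurableT mf' N0)).
  apply: (@eq_integrable _ _ _ mu _ _ (EFin \o g) _ fgN); first exact: measurableD.
  exact: (proj1 (@negligible_integrable _ _ _ mu _ _ _ mN measurableT mg' N0)).
split => //; rewrite /Rintegral.
rewrite (@negligible_integral _ _ _ mu _ _ _ mN measurableT if_ N0).
rewrite (@negligible_integral _ _ _ mu _ _ _ mN measurableT ig N0).
by congr fine; apply: eq_integral => x xN; rewrite -fgN.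
Qed.

Variables (h y : R).
Hypothesis h0 : 0 < h.
Let flip (x : measurableTypeR R) : measurableTypeR R := y - h * x.

Let measurable_flip : measurable_fun setT flip.
Proof.
rewrite (_ : flip = horner (y%:P - h *: 'X)); first exact: measurable_poly.
by apply/funext => x; rewrite hornerD hornerN hornerC hornerZ hornerX.
Qed.

(** The image of Lebesgue measure under the flip, scaled by [h], agrees with
    Lebesgue measure on intervals, hence everywhere. The basis
    functions are merely integrable, so the rule cannot come from the
    fundamental theorem of calculus. *)
Lemma ge0_integral_flip (F : R -> \bar R) :
  measurable_fun setT F -> (forall x, (0 <= F x)%E) ->
  (\int[mu]_x F x = h%:E * \int[mu]_x F (y - h * x)%R)%E.
Proof.
move=> mF F0.
pose hn := NngNum (ltW h0).
have muE A : measurable A -> mu A = mscale hn (pushforward mu flip) A.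
  apply: lebesgue_measure_unique => _ [[a b]] _ <-.
  rewrite /mscale /pushforward /=.
  change (mu `]a, b]%classic = h%:E * mu (flip @^-1` `]a, b]%classic))%E.
  have -> : flip @^-1` `]a, b]%classic = `[(y - b) / h, (y - a) / h[%classic.
    apply/seteqP; split=> x /=; rewrite !in_itv /= ler_pdivrMr// ltr_pdivlMr//.
      by rewrite /flip mulrC => /andP[ax xb]; apply/andP; split; lra.
    by rewrite /flip mulrC => /andP[ax xb]; apply/andP; split; lra.
  rewrite !lebesgue_measure_itv /= !lte_fin ltr_pM2r ?invr_gt0//.
  rewrite ltrD2l ltrN2; case: ifP => _; last by rewrite mule0.
  rewrite -!EFinD -EFinM; congr EFin.
  by field; rewrite gt_eqF.
rewrite (@eq_measure_integral _ _ _ _ (mscale hn (pushforward mu flip)))//; last first.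
  by move=> A mA _; exact: muE.
by rewrite ge0_integral_mscale// ge0_integral_pushforward.
Qed.

Lemma Rintegral_flip (g : R -> R) :
  mu.-integrable setT (EFin \o g) ->
  mu.-integrable setT (EFin \o (fun x => g (y - h * x))) /\
  Rintegral mu setT g = h * Rintegral mu setT (fun x => g (y - h * x)).
Proof.
move=> ig; have mg := measurable_int _ ig.
have mgf : measurable_fun setT (EFin \o (fun x => g (y - h * x))).
  exact: (measurableT_comp mg measurable_flip).
have igf : mu.-integrable setT (EFin \o (fun x => g (y - h * x))).
  apply/integrableP; split => //.
  case/integrableP : ig => _.
  rewrite (ge0_integral_flip (F := fun x => `|(EFin \o g) x|%E))//; last first.
    exact: measurableT_comp.
  rewrite !ltey; apply: contraNN => /eqP X_oo.
  by rewrite [X in (_ * X)%E]X_oo gt0_muley ?lte_fin.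
split => //.
rewrite /Rintegral.
transitivity (fine (h%:E * \int[mu]_x (g (y - h * x))%:E)%E); last first.
  by rewrite fineM//; exact: (integrable_fin_num measurableT igf).
congr fine.
rewrite integralE [in RHS]integralE.
rewrite (ge0_integral_flip (F := ((EFin \o g)^\+)%E))//; last first.
  exact: measurable_funepos.
rewrite (ge0_integral_flip (F := ((EFin \o g)^\-)%E))//; last first.
  exact: measurable_funeneg.
have := @muleBr R h%:E _ _ isT (integrable_add_def measurableT igf).
by move=> ->; congr (_ * _ - _ * _)%E; apply: eq_integral => x _;
  rewrite !unlock.
Qed.
End lebesgue_affine.

(** * The coefficients of the kernel *)

Section combination.
Variable R : realType.
Local Notation mu := (@lebesgue_measure R).

Lemma Rintegral_lincomb (I : finType) (c : I -> R) (F : I -> R -> R) :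
  (forall q, mu.-integrable setT (EFin \o F q)) ->
  mu.-integrable setT (EFin \o (fun x => \sum_q c q * F q x)) /\
  Rintegral mu setT (fun x => \sum_q c q * F q x)
  = \sum_q c q * Rintegral mu setT (F q).
Proof.
move=> iF; elim: (index_enum I) => [|q s [ints Es]].
  under eq_fun do rewrite big_nil; rewrite big_nil; split.
    exact: (@integrable0 _ _ _ mu).
  by rewrite Rintegral_cst// mul0r.
under eq_fun do rewrite big_cons; rewrite big_cons.
have iq : mu.-integrable setT (EFin \o (fun x => c q * F q x)).
  exact: (integrableZl measurableT (c q) (iF q)).
split; first exact: (integrableD measurableT iq ints).
by rewrite RintegralD// RintegralZl// Es.
Qed.

Lemma integrable_bsplineM k (t : nat -> R) (g : R -> R) :
  (forall i j, (i <= j <= k.+1)%N -> t i <= t j) -> t 0%N != t k.+1 ->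
  mu.-integrable setT (EFin \o g) ->
  mu.-integrable setT (EFin \o (fun x => bspline_germ k t x * g x)).
Proof.
move=> t_le t_neq ig.
have [mB [C BC] _] := bspline_germ_moment 0 t_le t_neq.
apply: (@integrableMr _ _ _ mu setT _ (bspline_germ k t) (EFin \o g)) => //.
exists C; split; first exact: num_real.
by move=> M CM x _; rewrite /= (le_trans (BC x))// ltW.
Qed.

Lemma integrable_bspline_horner k (t : nat -> R) (p : {poly R}) :
  (forall i j, (i <= j <= k.+1)%N -> t i <= t j) -> t 0%N != t k.+1 ->
  mu.-integrable setT (EFin \o (fun x => bspline_germ k t x * p.[x])).
Proof.
move=> t_le t_neq.
have [mB [C BC] _] := bspline_germ_moment 0 t_le t_neq.
have ip := @integrable_bounded_horner R _ p (t 0%N) (t k.+1) C mB (fun x _ => BC x).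
have := proj1 (@integrable_mkcond _ _ _ mu _ _ (measurable_itv _)) ip.
apply: eq_integrable => // x _; rewrite /patch mem_setE in_itv.
case: ifPn => // xab; suff B0 : bspline_germ k t x = 0 by rewrite /= B0 mul0r.
by apply: contraNeq xab; exact: bspline_germ_support.
Qed.

(** Reproduction of [(- y) ^+ d] at the point [e], the origin of the
    shifted knots, prescribes the moment of order [d] of [f] about [e].
    By Peano's formula for [('X - e%:P) ^+ (k.+1 + d)] the moments
    of the B-splines about [e] are, up to the binomial coefficient and [h ^+ d],
    the entries of the reproduction matrix of the unscaled knots. *)
Lemma siac_kernel_coefficients k r (J : 'I_r.+1 -> nat) (t : nat -> R)
    (h e : R) (f : R -> R) :
  0 < h ->
  (forall p q : 'I_r.+1, (p < q)%N -> (J p < J q)%N) ->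
  (forall p q : nat, (p <= q <= J ord_max + k + 1)%N -> t p <= t q) ->
  (forall q : 'I_r.+1, t (J q) <> t (J q + k + 1)%N) ->
  siac_kernel k J (fun p => h * t p + e) f ->
  exists2 c : 'cV[R]_r.+1,
    (forall s, (forall p, (p <= J ord_max + k + 1)%N -> s != h * t p + e) ->
      f s = \sum_q c q 0 * bspline_germ k (ascending (fun p => h * t p + e) (J q)) s) &
    reproduction_mx k J t *m c
    = diag_mx (\row_(i < r.+1) ((-1) ^+ i * 'C(i + k + 1, i)%:R))
      *m diag_mx (\row_(d < r.+1) h ^- d) *m (\col_(d < r.+1) e ^+ d).
Proof.
move=> h0 Jincr t_le t_neq [[c fE] f_mom].
have hn0 := lt0r_neq0 h0.
set n := (J ord_max + k + 1)%N in t_le fE *.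
set T := fun p => h * t p + e in fE f_mom *.
have Jn q : (J q + k.+1 <= n)%N.
  by have := index_le_max Jincr q; rewrite /n; lia.
have T_le q i j : (i <= j <= k.+1)%N -> ascending T (J q) i <= ascending T (J q) j.
  move=> /andP[ij jk]; rewrite lerD2r ler_pM2l// t_le// leq_add2l ij/=.
  by rewrite (leq_trans _ (Jn q))// leq_add2l.
have T_neq q : ascending T (J q) 0 != ascending T (J q) k.+1.
  rewrite (inj_eq (addIr _)) (inj_eq (mulfI hn0)) addn0.
  by apply/eqP; have := t_neq q; rewrite -addnA addn1.
have fE' s : (forall p, (p <= n)%N -> s != T p) ->
    f s = \sum_q c q * bspline_germ k (ascending T (J q)) s.
  move=> sT; rewrite fE => [|p pn]; last exact/eqP/sT.
  apply: eq_bigr => q _; rewrite bspline_off_knots// => i ik.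
  by apply: sT; rewrite (leq_trans _ (Jn q))// leq_add2l.
exists (\col_q c q).
  by move=> s sT; rewrite fE'//; apply: eq_bigr => q _; rewrite mxE.
apply/colP => d; rewrite -mulmxA mul_diag_mx mul_diag_mx !mxE.
have dr : (d <= r)%N by rewrite -ltnS.
have := f_mom d dr e; rewrite /convolution.
pose p : {poly R} := ('X - e%:P) ^+ (k.+1 + d).
pose N : R := 'C(d + k + 1, d)%:R.
have N0 : N != 0 by rewrite pnatr_eq0 -lt0n bin_gt0 -addnA leq_addr.
have pE s : (p^`N(k.+1)).[s] = N * (- (e - s)) ^+ d.
  rewrite horner_nderivn_XsubC_exp addKn opprB -mulr_natl; congr (_%:R * _).
  by rewrite -(bin_sub (leq_addr d _)) addKn addnC -addnA addn1.
pose F q s := bspline_germ k (ascending T (J q)) s * (p^`N(k.+1)).[s].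
have iF q : mu.-integrable setT (EFin \o F q).
  exact: (integrable_bspline_horner _ (T_le q) (T_neq q)).
have [isum Esum] := Rintegral_lincomb (fun q => N^-1 * c q) iF.
have [|_ ->] := @integral_finite_modification R
    (fun s => f s * (- (e - s)) ^+ d)
    (fun s => \sum_q N^-1 * c q * F q s) [seq T p | p <- iota 0 n.+1] _ isum.
  move=> s sT; rewrite fE'; last first.
    move=> i ik; apply: contraNneq sT => ->; apply: map_f.
    by rewrite mem_iota add0n ltnS.
  rewrite mulr_suml; apply: eq_bigr => q _.
  by rewrite /F pE; field.
rewrite Esum => moment.
have intF q : Rintegral mu setT (F q) = h ^+ d * reproduction_mx k J t d q.
  have [_ _ ->] := bspline_germ_moment p (T_le q) (T_neq q).
  rewrite (@germ_divdiff_affine R k.+1 (ascending t (J q)) h e)//.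
  rewrite mxE divdiff_monomial.
  have -> : p \Po (h *: 'X + e%:P) = h ^+ (k.+1 + d) *: 'X^(k + 1 + d).
    by rewrite comp_XsubC_exp addrK exprZn addn1.
  rewrite germ_divdiffZ mulrA exprD; congr (_ * _).
  by rewrite mulrA mulVf ?mul1r// expf_neq0.
have hd0 : h ^+ d != 0 by rewrite expf_neq0.
transitivity (N * h ^- d * (\sum_q N^-1 * c q * Rintegral mu setT (F q))).
  rewrite mulr_sumr; apply: eq_bigr => q _.
  by rewrite intF !mxE; field; rewrite N0 hd0.
by rewrite moment -/N [(- e) ^+ d]exprNn; ring.
Qed.
End combination.

(** * Convolution with one B-spline *)

Section convolution.
Variable R : realType.
Local Notation mu := (@lebesgue_measure R).

(** The substitution of [y - h * s] for [s] maps the knots, which move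
    along with [y], to the fixed reflected knots; this is why the value does not
    depend on [y]. The factor [h] of the substitution cancels the one
    in the scaling of the B-spline. *)
Lemma Rintegral_bspline_flip k n j (t : nat -> R) (h lambda y : R)
    (g : R -> R) :
  0 < h -> (forall p q : nat, (p <= q <= n)%N -> t p <= t q) ->
  (j + k.+1 <= n)%N -> t j != t (j + k.+1)%N ->
  mu.-integrable setT (EFin \o g) ->
  let T := ascending (fun p => h * t p + (y - h * lambda)) j in
  mu.-integrable setT (EFin \o (fun s => bspline_germ k T s * g (y - s))) /\
  Rintegral mu setT (fun s => bspline_germ k T s * g (y - s))
  = Rintegral mu `[lambda - t n, lambda - t 0%N]
      (fun s => g (h * s) * bspline k (fun l => lambda - t (j + k.+1 - l)%N) s).
Proof.
move=> h0 t_le jn t_neq ig T; have hn0 := lt0r_neq0 h0.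
set tj := ascending t j.
have tj_le p q : (p <= q <= k.+1)%N -> tj p <= tj q.
  by move=> /andP[pq qk]; rewrite /tj /ascending t_le//; lia.
have tj_neq : tj 0%N != tj k.+1 by rewrite /tj /ascending addn0.
have T_le p q : (p <= q <= k.+1)%N -> T p <= T q.
  by move=> pq; rewrite lerD2r ler_pM2l// tj_le.
have T_neq : T 0%N != T k.+1.
  by rewrite (inj_eq (addIr _)) (inj_eq (mulfI hn0)).
have [ig1 _] := @Rintegral_flip R 1 y ltr01 g ig.
have iF : mu.-integrable setT (EFin \o (fun s => bspline_germ k T s * g (y - s))).
  apply: integrable_bsplineM => //.
  by apply: eq_integrable ig1 => // s _; rewrite /= mul1r.
split=> //; have [iFh ->] := Rintegral_flip y h0 iF.
rewrite -RintegralZl//.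
have FhE s : h * (bspline_germ k T (y - h * s) * g (y - (y - h * s)))
    = bspline_germ k tj (lambda - s) * g (h * s).
  rewrite (_ : y - h * s = h * (lambda - s) + (y - h * lambda)); last by ring.
  rewrite [bspline_germ k T _](@bspline_germ_affine R k tj h (y - h * lambda))//.
  rewrite !mulrA divff// mul1r; congr (_ * g _); ring.
have iFh' := integrableZl measurableT h iFh.
rewrite [RHS]Rintegral_mkcond.
set tr := fun l : nat => _.
set K := patch _ _ _.
suff KE s : s \notin [seq lambda - tj i | i <- iota 0 k.+2] ->
    K s = h * (bspline_germ k T (y - h * s) * g (y - (y - h * s))).
  by have [_ ->] := integral_finite_modification KE iFh'.
move=> sT; rewrite FhE /K /patch mem_setE in_itv.
have s_neq i : (i <= k.+1)%N -> lambda - s != tj i.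
  move=> ik; apply: contraNneq sT => /eqP.
  rewrite subr_eq => /eqP sE; apply/mapP; exists i; last by rewrite sE; ring.
  by rewrite mem_iota add0n ltnS.
case: ifPn => sab.
  have trE i : (i <= k.+1)%N -> tr i = lambda - tj (k.+1 - i)%N.
    by move=> ik; rewrite /tr /tj /ascending addnBA.
  rewrite mulrC bspline_off_knots => [|i ik].
    rewrite (eq_bspline_germ s trE).
    have := @bspline_germ_reflect R k tj lambda (lambda - s) tj_le s_neq.
    by rewrite opprB addrCA subrr addr0 => ->.
  rewrite trE//; apply: contraNneq (s_neq (k.+1 - i)%N (leq_subr _ _)).
  by move=> ->; apply/eqP; ring.
suff -> : bspline_germ k tj (lambda - s) = 0 by rewrite mul0r.
apply: contraNeq sab => /(bspline_germ_support tj_le) /andP[s1 s2].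
have t1 : t (j + k.+1)%N <= t n by rewrite t_le// jn leqnn.
have t2 : t 0%N <= t j by rewrite t_le// (leq_trans (leq_addr _ _) jn).
move: s1 s2; rewrite /tj /ascending addn0 => s1 s2.
by rewrite /=; apply/andP; split; lra.
Qed.
End convolution.

Unset Implicit Arguments.

(** * The convolution as a polynomial *)

Theorem corollary4p1 (R : realType) (k r m n : nat)
  (J : 'I_r.+1 -> nat) (t : nat -> R)
  (J0 : J ord0 = 0%N)
  (Jincr : forall p q : 'I_r.+1, (p < q)%N -> (J p < J q)%N)
  (n_def : n = (J ord_max + k + 1)%N)
  (t_nondecr : forall p q : nat, (p <= q <= n)%N -> t p <= t q)
  (t_not_all_equal : forall q : 'I_r.+1, t (J q) <> t (J q + k + 1)%N)
  (h lambda a b : R) (h_gt0 : 0 < h)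
  (s : 'I_m.+1 -> R)
  (s_incr : forall i j : 'I_m.+1, (i < j)%N -> s i < s j)
  (a_def : a = h * s ord0) (b_def : b = h * s ord_max)
  (phi : ('I_m.+1 -> R) -> 'I_m.+1 -> R -> R)
  (phi_free : linearly_independent_on `[a, b] (phi (fun i => h * s i)))
  (phi_int : forall i, (@lebesgue_measure R).-integrable `[a, b]
               (EFin \o phi (fun j => h * s j) i))
  (phi_out : forall i x, ~~ (a <= x <= b) -> phi (fun j => h * s j) i x = 0)
  (phi_scale : forall i x, phi (fun j => h * s j) i (h * x) = phi s i x)
  (u_ : 'I_m.+1 -> R -> R) (u : R -> R -> R)
  (u_def : forall x tau : R, 0 <= tau ->
     u x tau = \sum_(i < m.+1) u_ i tau * phi (fun j => h * s j) i x)
  (f : R -> R -> R)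
  (f_kernel : forall x, siac_kernel k J (fun p => h * t p + (x - h * lambda)) (f x))
  (I : {set 'I_m.+1})
  (I_def : I = overlapping (phi (fun j => h * s j))
                 `[h * (lambda - t n), h * (lambda - t 0%N)])
  (tau : R) (tau_ge0 : 0 <= tau) (l : nat) (x : R) :
  (derive1n l (fun y => convolution (f y) (fun z => u z tau) y) x)%:M
  = (\row_(p < #|I|) u_ (enum_val p) tau)
    *m Q_mx k n J t lambda (phi s) I
    *m diag_mx (\row_(d < r.+1) h ^- d)
    *m (\row_(d < r.+1) derive1n l (fun y : R => (y - h * lambda) ^+ d) x)^T
  :> 'M[R]_1.
Proof.
have hn0 := lt0r_neq0 h_gt0.
set P := phi (fun j => h * s j) in phi_free phi_int phi_out phi_scale u_def I_def *.
have mI : measurable `[a, b]%classic by exact: measurable_itv.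
have P_int i : (@lebesgue_measure R).-integrable setT (EFin \o P i).
  have := proj1 (@integrable_mkcond _ _ _ (@lebesgue_measure R) _ _ mI) (phi_int i).
  apply: eq_integrable => // y _; rewrite /patch mem_setE in_itv.
  by case: ifPn => // yab; rewrite /= phi_out.
pose K i q := Rintegral (@lebesgue_measure R) `[lambda - t n, lambda - t 0%N]
  (fun z => P i (h * z) * bspline k (fun l => lambda - t (J q + k.+1 - l)%N) z).
have t_le p q : (p <= q <= J ord_max + k + 1)%N -> t p <= t q.
  by rewrite -n_def; exact: t_nondecr.
have Jn q : (J q + k.+1 <= n)%N.
  by have := index_le_max Jincr q; rewrite n_def; lia.
(* A basis function whose support misses the interval vanishes on it. *)
have K0 i q : i \notin I -> K i q = 0.
  move=> iI; rewrite /K (@eq_Rintegral _ _ _ _ _ (cst 0)).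
    by rewrite Rintegral_cst ?mul0r.
  move=> z; rewrite inE /= in_itv /= => zt.
  suff -> : P i (h * z) = 0 by rewrite mul0r.
  apply: contraNeq iI => Pz; rewrite I_def inE; apply/asboolP.
  exists (h * z); split; first exact: subset_closure.
  by rewrite /= in_itv /= !ler_pM2l.
(* The reversal matrix undoes the reversal of the columns of [G_mx]. *)
have GA p q : (G_mx k n (mirror J) t lambda (phi s) I *m reversal_mx R r) p q
    = K (enum_val p) q.
  rewrite mxE (bigD1 (rev_ord q))//= big1 ?addr0 => [|q' q'q]; last first.
    rewrite [X in _ * X]mxE; case: eqP => [qE|_]; last by rewrite mulr0.
    by rewrite qE rev_ordK eqxx in q'q.
  rewrite [X in _ * X]mxE rev_ordK eqxx mulr1 mxE.
  apply: eq_Rintegral => z _; rewrite phi_scale; congr (_ * bspline k _ z).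
  apply/funext => j; rewrite /descending /mirror rev_ordK; congr (_ - t (_ - _)%N).
  by rewrite n_def; have := Jn q; rewrite n_def; lia.
set E := _ *m Q_mx _ _ _ _ _ _ _ *m _.
have convE y : convolution (f y) (fun z => u z tau) y
    = \sum_d E 0 d * (y - h * lambda) ^+ d.
  have [c fE cE] := siac_kernel_coefficients h_gt0 Jincr t_le
    t_not_all_equal (f_kernel y).
  have Mu := reproduction_mx_unit Jincr t_le t_not_all_equal.
  transitivity (\sum_q c q 0 * \sum_i u_ i tau * K i q).
    pose F (qi : 'I_r.+1 * 'I_m.+1) z := bspline_germ k
      (ascending (fun p => h * t p + (y - h * lambda)) (J qi.1)) z * P qi.2 (y - z).
    have t_neq q : t (J q) != t (J q + k.+1)%N.
      by apply/eqP; have := t_not_all_equal q; rewrite -addnA addn1.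
    have FK qi : (@lebesgue_measure R).-integrable setT (EFin \o F qi) /\
        Rintegral (@lebesgue_measure R) setT (F qi) = K qi.2 qi.1.
      exact: (Rintegral_bspline_flip lambda y h_gt0 t_nondecr (Jn qi.1)
                (t_neq qi.1) (P_int qi.2)).
    have [iF EF] := Rintegral_lincomb (fun qi => c qi.1 0 * u_ qi.2 tau)
                      (fun qi => (FK qi).1).
    rewrite /convolution.
    have FE z : z \notin [seq h * t p + (y - h * lambda) | p <- iota 0 n.+1] ->
        f y z * u (y - z) tau = \sum_qi c qi.1 0 * u_ qi.2 tau * F qi z.
      move=> zt; rewrite fE => [|p pn]; last first.
        apply: contraNneq zt => ->; apply/mapP; exists p => //.
        by rewrite mem_iota add0n ltnS n_def.
      rewrite u_def// big_distrlr pair_big /=; apply: eq_bigr => qi _.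
      by rewrite /F mulrACA.
    have [_ ->] := integral_finite_modification FE iF.
    rewrite EF; under [RHS]eq_bigr do rewrite mulr_sumr.
    rewrite pair_big /=; apply: eq_bigr => qi _.
    by rewrite (FK qi).2 mulrA.
  transitivity ((E *m \col_(d < r.+1) (y - h * lambda) ^+ d) 0 0); last first.
    by rewrite mxE; apply: eq_bigr => d _; rewrite [X in _ * X]mxE.
  rewrite /E /Q_mx -!mulmxA [diag_mx _ *m (_ *m _)]mulmxA -cE mulKmx//.
  rewrite !mulmxA -(mulmxA _ _ (reversal_mx R r)) mxE.
  apply: eq_bigr => q _; rewrite mulrC; congr (_ * _).
  rewrite mxE.
  under [RHS]eq_bigr do rewrite GA mxE.
  rewrite -(big_enum_val (fun i => u_ i tau * K i q)).
  rewrite (bigID (mem I))/= [X in _ + X]big1 ?addr0// => i iI.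
  by rewrite K0// mulr0.
clearbody E.
apply/matrixP => i j; rewrite !ord1 !mxE mulr1n.
pose p : {poly R} := \sum_d E 0 d *: ('X - (h * lambda)%:P) ^+ d.
have -> : (fun y => convolution (f y) (fun z => u z tau) y) = horner p.
  apply/funext => y; rewrite convE horner_sum; apply: eq_bigr => d _.
  by rewrite hornerZ horner_exp hornerD hornerN hornerC hornerX.
rewrite derive1n_horner linear_sum horner_sum; apply: eq_bigr => d _.
rewrite linearZ hornerZ /=; congr (_ * _).
rewrite -derive1n_horner !mxE.
congr (derive1n l _ x); apply/funext => y.
by rewrite horner_exp hornerD hornerN hornerC hornerX.
Qed.
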